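(* Let $A$ be a power-associative algebra over a field $F$ which is algebraic (every element of $A$ satisfies a nonzero polynomial equation over $F$) and has no zero divisors. If $R$ is a Rota–Baxter operator of weight zero on $A$, then $R=0$.
   Context: An algebra is a vector space with a bilinear product, not necessarily associative. A linear operator $R\colon A\to A$ is a Rota–Baxter operator (RB-operator) of weight $\lambda\in F$ if $R(x)R(y)=R(R(x)y+xR(y)+\lambda xy)$ for all $x,y\in A$. An algebra is power-associative if every single element generates an associative subalgebra. *)

(* Defs.v *)
From HB Require Import structures.
From mathcomp Require Import all_boot all_order all_algebra.
Set Implicit Arguments. Unset Strict Implicit. Unset Printing Implicit Defensive.
Import GRing.Theory.
Local Open Scope ring_scope.

Definition bilinear_prod (F : fieldType) (A : lmodType F) (m : A -> A -> A) :=
  (forall (a : F) (x y z : A), m (a *: x + y) z = a *: m x z + m y z) /\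
  (forall (a : F) (x y z : A), m z (a *: x + y) = a *: m z x + m z y).

Inductive gen_subalg (F : fieldType) (A : lmodType F) (m : A -> A -> A) (x : A)
  : A -> Prop :=
  | gen_base : gen_subalg m x x
  | gen_zero : gen_subalg m x 0
  | gen_lin : forall (a : F) u v, gen_subalg m x u -> gen_subalg m x v ->
      gen_subalg m x (a *: u + v)
  | gen_mul : forall u v, gen_subalg m x u -> gen_subalg m x v ->
      gen_subalg m x (m u v).

Definition power_associative (F : fieldType) (A : lmodType F) (m : A -> A -> A) :=
  forall x u v w : A, gen_subalg m x u -> gen_subalg m x v -> gen_subalg m x w ->
    m (m u v) w = m u (m v w).

(* npow m x n = x^(n+1), left-normed powers. *)
Fixpoint npow (A : Type) (m : A -> A -> A) (x : A) (n : nat) : A :=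
  match n with
  | O => x
  | S k => m (npow m x k) x
  end.

(* Algebraic: every element is a root of a nonzero polynomial over F
   (without constant term, since A need not be unital):
   p(x) = sum_{i >= 1} p_i x^i = 0. *)
Definition algebraic_alg (F : fieldType) (A : lmodType F) (m : A -> A -> A) :=
  forall x : A, exists p : {poly F},
    [/\ p != 0, p`_0 = 0 &
        \sum_(1 <= i < size p) p`_i *: npow m x i.-1 = 0].

Definition no_zero_divisors (F : fieldType) (A : lmodType F) (m : A -> A -> A) :=
  forall x y : A, m x y = 0 -> x = 0 \/ y = 0.

Definition rota_baxter (F : fieldType) (A : lmodType F) (m : A -> A -> A)
  (lambda : F) (R : A -> A) :=
  (forall (a : F) (x y : A), R (a *: x + y) = a *: R x + R y) /\
  (forall x y : A, m (R x) (R y) = R (m (R x) y + m x (R y) + lambda *: m x y)).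

(* Main.v *)
Require Import Defs.
From HB Require Import structures.
From mathcomp Require Import all_boot all_order all_algebra.
Import GRing.Theory.
Local Open Scope ring_scope.

(** A nonzero element of the image of [R] generates a field inside that image,
    so some nonzero idempotent is [e = R z]; put [T x = e x + x e].  Since
    [e = e e = R (T z)], [T] acts as the identity on [z] modulo the kernel of
    [R], which [T] preserves.  On the other hand [1] is not an eigenvalue of
    [T], so it suffices to find a nonzero polynomial that kills [z] under [T].

    If [2 <> 0], third and fourth power associativity, polarized at [e + y] and
    [e - y] so that no assumption on the number of scalars is needed, give
    [T k = 2 k] for [k = T z - z].

    If [2 = 0], the commutator is a Lie bracket and [T = ad e].  Squaring need
    not be a restricted structure when [F] has two elements, but its defect is
    a symmetric bilinear map, and this forces
    [T^2 (y^(2^n)) = (1 + T)^n T^2 y] for [y = T^2 z].  A linear relation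
    between the powers [y^(2^n)] then gives the polynomial in [T]. *)

(** * A decision procedure for abelian groups *)

Inductive zexpr :=
  | ZVar of nat | ZZero | ZAdd of zexpr & zexpr | ZOpp of zexpr.

Fixpoint zeval (V : zmodType) (env : seq V) (t : zexpr) : V :=
  match t with
  | ZVar i => env`_i
  | ZZero => 0
  | ZAdd a b => zeval V env a + zeval V env b
  | ZOpp a => - zeval V env a
  end.

Fixpoint zcoef (t : zexpr) (i : nat) : int :=
  match t with
  | ZVar j => (j == i)%:R
  | ZZero => 0
  | ZAdd a b => zcoef a i + zcoef b i
  | ZOpp a => - zcoef a i
  end.

Lemma zevalE (V : zmodType) (env : seq V) (t : zexpr) :
  zeval V env t = \sum_(i < size env) env`_i *~ zcoef t i.
Proof.
elim: t => [j||a IHa b IHb|a IHa] /=.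
- case: (ltnP j (size env)) => [ltj|lej].
    rewrite (bigD1 (Ordinal ltj)) //= eqxx mulr1z big1 ?addr0 // => i.
    by rewrite -val_eqE /= eq_sym => /negPf ->; rewrite mulr0z.
  rewrite nth_default // big1 // => i _.
  by rewrite gtn_eqF ?mulr0z // (leq_trans (ltn_ord i)).
- by rewrite big1 // => i _; rewrite mulr0z.
- by rewrite IHa IHb -big_split; apply: eq_bigr => i _; rewrite mulrzDr.
- by rewrite IHa -sumrN; apply: eq_bigr => i _; rewrite mulrNz.
Qed.

Lemma zexprP (V : zmodType) (env : seq V) (a b : zexpr) :
  all (fun i => zcoef a i == zcoef b i) (iota 0 (size env)) ->
  zeval V env a = zeval V env b.
Proof.
move=> /allP eqab; rewrite !zevalE; apply: eq_bigr => i _.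
by rewrite (eqP (eqab i _)) // mem_iota ltn_ord.
Qed.

Lemma zexpr2P (V : zmodType) (env : seq V) (a b : zexpr) :
  (forall v : V, v + v = 0) ->
  all (fun i => ~~ odd `|zcoef a i - zcoef b i|%N) (iota 0 (size env)) ->
  zeval V env a = zeval V env b.
Proof.
move=> vv /allP eqab; rewrite !zevalE; apply/eqP; rewrite -subr_eq0 -sumrB.
apply/eqP/big1 => i _; rewrite -mulrzBr.
have v2n (n : nat) : ~~ odd n -> forall v : V, v *+ n = 0.
  by move=> /even_halfK <- v; rewrite -muln2 mulnC mulrnA mulr2n vv mul0rn.
have := eqab i; rewrite mem_iota ltn_ord => /(_ isT).
move: (zcoef a i - zcoef b i) => c /v2n /(_ env`_i).
by case: c => [k|k] //; rewrite NegzE mulrNz abszN => /= c0; rewrite -[LHS]/(- _) [X in - X]c0 oppr0.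
Qed.

Ltac zmod_index x env :=
  lazymatch env with
  | cons x _ => constr:(O)
  | cons _ ?env' => let n := zmod_index x env' in constr:(S n)
  end.

(** The inner [match] is not lazy: when [zmod_index] does not find the atom, it backtracks to the
    branch that adds it. *)
Ltac zmod_env t env :=
  lazymatch t with
  | @GRing.add _ ?a ?b => let env' := zmod_env a env in zmod_env b env'
  | @GRing.opp _ ?a => zmod_env a env
  | @GRing.zero _ => env
  | _ => match env with
         | _ => let _ := zmod_index t env in env
         | _ => constr:(cons t env)
         end
  end.

Ltac zmod_reify t env :=
  lazymatch t with
  | @GRing.add _ ?a ?b =>
      let a' := zmod_reify a env in let b' := zmod_reify b env in
      constr:(ZAdd a' b')
  | @GRing.opp _ ?a => let a' := zmod_reify a env in constr:(ZOpp a')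
  | @GRing.zero _ => constr:(ZZero)
  | _ => let n := zmod_index t env in constr:(ZVar n)
  end.

Ltac zmod_with tac :=
  lazymatch goal with
  | |- @eq ?V ?a ?b =>
      let env0 := constr:(@nil V) in
      let env1 := zmod_env a env0 in
      let env := zmod_env b env1 in
      let a' := zmod_reify a env in
      let b' := zmod_reify b env in
      tac env a' b'; vm_compute; reflexivity
  end.

Ltac zmod := zmod_with ltac:(fun env a b => apply: (zexprP _ env a b)).
Ltac zmod2 vv := zmod_with ltac:(fun env a b => apply: (zexpr2P _ env a b vv)).

(** Lets [zmod] and [zmod2] exploit one known equation: the second premise is a formal identity. *)
Lemma zmod_subst (V : zmodType) (a b u v : V) : a = b -> u - v = a - b -> u = v.
Proof. by move=> -> /eqP; rewrite subrr subr_eq0 => /eqP. Qed.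

(** * Squaring in characteristic two *)

(* In characteristic 2, [br] is the commutator of a third-power associative
   product and [s] the squaring map; [sdef] measures how far [s] is from being
   a restricted structure on the Lie algebra [V]. *)
Section LieSquare.
Variables (V : zmodType) (br : V -> V -> V) (s : V -> V).
Hypothesis vv : forall v : V, v + v = 0.
Hypothesis brDl : forall x y z, br (x + y) z = br x z + br y z.
Hypothesis brC : forall x y, br x y = br y x.
Hypothesis brxx : forall x, br x x = 0.
Hypothesis sD : forall x y, s (x + y) = s x + s y + br x y.
Hypothesis brsx : forall x, br (s x) x = 0.

Let brDr x y z : br z (x + y) = br z x + br z y.
Proof. by rewrite brC brDl !(brC _ z). Qed.

Let br0r x : br x 0 = 0.
Proof. by rewrite -(vv 0) brDr vv. Qed.

Let br0l x : br 0 x = 0.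
Proof. by rewrite brC br0r. Qed.

Definition sdef x y := br (s x) y + br x (br x y).

Let sdefDr x y z : sdef x (y + z) = sdef x y + sdef x z.
Proof. by rewrite /sdef !brDr; zmod. Qed.

(** Polarization of [br (s x) x = 0] at [x + y]. *)
Lemma sdefC x y : sdef x y = sdef y x.
Proof.
apply: zmod_subst (brsx (x + y)) _.
rewrite sD !brDl !brDr !brsx /sdef (brC (br x y) x) (brC (br x y) y) (brC y x).
zmod2 vv.
Qed.

Let sdefDl x y z : sdef (x + y) z = sdef x z + sdef y z.
Proof. by rewrite sdefC sdefDr !(sdefC z). Qed.

Lemma sdefxx x : sdef x x = 0.
Proof. by rewrite /sdef brsx brxx br0r addr0. Qed.

(** By symmetry [sdef] is additive on the left; expanding it there leaves exactly the Jacobi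
    terms. *)
Lemma br_jacobi x y z : br x (br y z) = br (br x y) z + br y (br x z).
Proof.
apply: zmod_subst (sdefDl x y z) _.
by rewrite /sdef sD !brDl !brDr; zmod2 vv.
Qed.

(** In characteristic 2 the square of the derivation [br x] is again a derivation. *)
Lemma sdef_der x y z : sdef x (br y z) = br (sdef x y) z + br y (sdef x z).
Proof.
rewrite /sdef !brDl !brDr (br_jacobi (s x)) (br_jacobi x y z) brDr.
rewrite (br_jacobi x (br x y)) (br_jacobi x y (br x z)).
zmod2 vv.
Qed.

Let sdef2 x y := sdef (s x) y + br x (sdef x y).

Let sdef2Dl x y z : sdef2 (x + y) z = sdef2 x z + sdef2 y z.
Proof.
rewrite /sdef2 sD !sdefDl !brDl !(brDr (sdef _ _) (sdef _ _)).
rewrite (sdefC (br x y)) sdef_der (brC (sdef z x)) (sdefC z x) (sdefC z y).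
zmod2 vv.
Qed.

Let sdef2_der x y z : sdef2 x (br y z) =
  br (sdef2 x y) z + br y (sdef2 x z)
  + (br (br x y) (sdef x z) + br (sdef x y) (br x z)).
Proof.
rewrite /sdef2 !sdef_der !(brDl (sdef _ _)) !(brDr (sdef _ _)).
rewrite !(brDr (br (sdef _ _) _)).
rewrite (br_jacobi x (sdef x y) z) (br_jacobi x y (sdef x z)).
zmod2 vv.
Qed.

(* [sdef2] is additive in its first variable, hence so is its failure to be a
   derivation, which is visibly quadratic: the polarization vanishes. *)
Lemma br_sdef x y z : br (br x y) (sdef y z) = br (sdef x y) (br y z).
Proof.
(* The argument [br y z] repeats [y], so two of the four polarized terms contain [br y y] or
   [sdef y y] and vanish. *)
have := sdef2Dl x y (br y z).
rewrite !sdef2_der (sdef2Dl x y y) (sdef2Dl x y z) !sdefDl !(brDl x y).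
rewrite sdefxx !brxx !addr0 (brDl (sdef2 x y)) (brDr (sdef2 x z)).
rewrite (brDr (sdef x z)) (brDr (br x z)) !br0l => H.
apply: zmod_subst H _; zmod2 vv.
Qed.

(** * The operator [br e] for an element [e] fixed by [s] *)

Variable e : V.
Hypothesis see : s e = e.
Let T := br e.

Let TD x y : T (x + y) = T x + T y.
Proof. exact: brDr. Qed.

Let T_der x y : T (br x y) = br (T x) y + br x (T y).
Proof. exact: br_jacobi. Qed.

Let T_sqr x : T (s x) = br (T x) x + T x + T (T x).
Proof.
apply: zmod_subst (sdefC e x) _.
by rewrite /T /sdef see (brC (s x)) (brC x e) (brC (br e x) x); zmod2 vv.
Qed.

(** This is [br_sdef] with [e] in the middle, where [sdef e] is [T + T^2]; the terms
    [br (T x) (T y)] cancel. *)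
Let T_adj x y : br (T x) (T (T y)) = br (T (T x)) (T y).
Proof.
apply: zmod_subst (br_sdef x e y) _.
by rewrite /T (sdefC x) /sdef see (brC x e) !brDl !brDr; zmod2 vv.
Qed.

Let T_br x y : T (br (T x) (T y)) = 0.
Proof. by rewrite T_der T_adj vv. Qed.

Let S x := x + T x.

Let T_iterS n x : T (iter n S x) = iter n S (T x).
Proof. by elim: n => //= n IHn; rewrite {1}/S TD IHn. Qed.

Let br_ker q t : T (T q) = 0 -> T (br q (T (T t))) = 0 ->
  br q (T (T (T t))) = 0.
Proof.
move=> TTq; rewrite T_der T_adj TTq br0l add0r; exact.
Qed.

(** By [T_sqr], each squaring contributes a factor [1 + T] up to the bracket [br (T x) x]; the work
    is to show that [T] kills this bracket. *)
Lemma iter_sqr (z : V) (n : nat) :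
    let y := T (T z) in
    (forall k, br (iter k s y) y = 0) ->
  T (T (iter n s y)) = iter n S (T (T y)).
Proof.
move=> y comm; elim: n => //= n IHn.
set x := iter n s y in IHn *; set t := iter n S z.
have TTt : T (T t) = iter n S y by rewrite !T_iterS.
(* [T (T t)] is [S^n y], the linear model of [x]. The error [q] is killed by [T^2], and repeated use
   of [br_ker] shows that it commutes with every [S^k (T^2 y)], in particular with [T^2 x]. *)
pose q := x + T (T t).
have TTq : T (T q) = 0 by rewrite !TD IHn TTt !T_iterS vv.
have q1 : br q (T y) = 0.
  by apply: br_ker => //; rewrite brDl comm add0r T_br.
have q2 : br q (T (T y)) = 0.
  by apply: (br_ker q (T z)) => //; rewrite [br q _]q1 /T br0r.
have qn k : br q (iter k S (T (T y))) = 0.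
  elim: k => //= k IHk; rewrite {1}/S brDr IHk add0r -!T_iterS.
  by apply: br_ker => //; rewrite !T_iterS IHk /T br0r.
have TTx : T (T x) = T (T (T (T t))) by rewrite IHn TTt !T_iterS.
have brx : br (T (T x)) x = 0.
  have xq : x = q + T (T t) by rewrite /q -addrA vv addr0.
  rewrite {2}xq brDr (brC _ q) {1}IHn qn add0r TTx.
  by rewrite -(T_adj (T (T t)) (T t)) brxx.
by rewrite T_sqr !TD T_der brx brxx !add0r IHn.
Qed.

End LieSquare.

(** * One-generated subalgebras *)

Section Algebra.
Variables (F : fieldType) (A : lmodType F) (m : A -> A -> A).
Hypothesis m_bilinear : bilinear_prod m.
Hypothesis m_pa : power_associative m.

Lemma mulvDl x y z : m (x + y) z = m x z + m y z.
Proof. by have := m_bilinear.1 1 x y z; rewrite !scale1r. Qed.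

Lemma mulvDr x y z : m z (x + y) = m z x + m z y.
Proof. by have := m_bilinear.2 1 x y z; rewrite !scale1r. Qed.

Lemma mul0v x : m 0 x = 0.
Proof. by apply: (addrI (m 0 x)); rewrite -mulvDl !addr0. Qed.

Lemma mulv0 x : m x 0 = 0.
Proof. by apply: (addrI (m x 0)); rewrite -mulvDr !addr0. Qed.

Lemma mulZv a x y : m (a *: x) y = a *: m x y.
Proof. by have := m_bilinear.1 a x 0 y; rewrite mul0v !addr0. Qed.

Lemma mulvZ a x y : m x (a *: y) = a *: m x y.
Proof. by have := m_bilinear.2 a y 0 x; rewrite mulv0 !addr0. Qed.

Lemma mulNv x y : m (- x) y = - m x y.
Proof. by rewrite -scaleN1r mulZv scaleN1r. Qed.

Lemma mulvN x y : m x (- y) = - m x y.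
Proof. by rewrite -scaleN1r mulvZ scaleN1r. Qed.

Lemma npow_gen x i : gen_subalg m x (npow m x i).
Proof. elim: i => [|i IHi] /=; first exact: gen_base.
by apply: gen_mul => //; apply: gen_base. Qed.

Lemma npowD x i j : m (npow m x i) (npow m x j) = npow m x (i + j).+1.
Proof.
elim: j => [|j IHj] /=; first by rewrite addn0.
by rewrite -(m_pa x) ?IHj ?addnS //; try exact: npow_gen; apply: gen_base.
Qed.

(** * Polynomials evaluated along a sequence of vectors *)

Lemma poly_mono_ind (P : {poly F} -> Prop) : P 0 ->
  (forall p q, P p -> P q -> P (p + q)) -> (forall a n, P (a *: 'X^n)) ->
  forall p, P p.
Proof. by move=> P0 PD PX p; rewrite -(coefK p) poly_def; apply: big_ind. Qed.

(** The linear map sending ['X^i] to [f i]. The sequence is arbitrary, so that powers, iterated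
    squares and orbits of an operator are treated alike. *)
Definition peval (f : nat -> A) (p : {poly F}) :=
  \sum_(i < size p) p`_i *: f i.

Lemma pevalE f (p : {poly F}) n : (size p <= n)%N ->
  peval f p = \sum_(i < n) p`_i *: f i.
Proof.
move=> le_pn; rewrite /peval (big_ord_widen n (fun i => p`_i *: f i)) //.
rewrite [RHS](bigID (fun i : 'I_n => (i < size p)%N)) /= [X in _ + X]big1 ?addr0 //.
by move=> i; rewrite -leqNgt => le_pi; rewrite nth_default // scale0r.
Qed.

Lemma pevalD f p q : peval f (p + q) = peval f p + peval f q.
Proof.
rewrite (pevalE f (p + q) _ (size_polyD p q)).
rewrite (pevalE f p _ (leq_maxl _ (size q))) (pevalE f q _ (leq_maxr (size p) _)).
by rewrite -big_split; apply: eq_bigr => i _; rewrite coefD scalerDl.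
Qed.

Lemma pevalZ f a p : peval f (a *: p) = a *: peval f p.
Proof.
rewrite (pevalE f (a *: p) _ (size_scale_leq a p)) scaler_sumr.
by apply: eq_bigr => i _; rewrite coefZ scalerA.
Qed.

Lemma peval0 f : peval f 0 = 0.
Proof. by rewrite /peval size_poly0 big_ord0. Qed.

Lemma pevalN f p : peval f (- p) = - peval f p.
Proof. by rewrite -[- p]scaleN1r pevalZ scaleN1r. Qed.

Lemma pevalXn f n : peval f 'X^n = f n.
Proof.
rewrite (pevalE f 'X^n n.+1) ?size_polyXn // (bigD1 ord_max) //=.
rewrite coefXn eqxx scale1r big1 ?addr0 // => i.
by rewrite -val_eqE /= coefXn => /negPf ->; rewrite scale0r.
Qed.

Lemma pevalMX f p : peval f (p * 'X) = peval (fun i => f i.+1) p.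
Proof.
elim/poly_mono_ind: p => [|p q IHp IHq|a n]; first by rewrite mul0r !peval0.
  by rewrite mulrDl !pevalD IHp IHq.
by rewrite -scalerAl -exprSr !pevalZ !pevalXn.
Qed.

Lemma pevalC f c : peval f c%:P = c *: f 0%N.
Proof. by rewrite -[c%:P]mulr1 mul_polyC -(expr0 'X) pevalZ pevalXn. Qed.

Lemma peval_linear (g : A -> A) f p :
  (forall a x y, g (a *: x + y) = a *: g x + g y) ->
  g (peval f p) = peval (g \o f) p.
Proof.
move=> g_lin.
have gD x y : g (x + y) = g x + g y by have := g_lin 1 x y; rewrite !scale1r.
have g0 : g 0 = 0 by apply: (addrI (g 0)); rewrite -gD !addr0.
have gZ a x : g (a *: x) = a *: g x by have := g_lin a x 0; rewrite g0 !addr0.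
by rewrite (big_morph _ gD g0); apply: eq_bigr => i _; rewrite gZ.
Qed.

(* [xeval x p] is [x p(x)], so that constant terms make sense. *)
Local Notation xeval x := (peval (npow m x)).

Lemma xeval1 x : xeval x 1 = x.
Proof. by rewrite -(expr0 'X) pevalXn. Qed.

(** Each factor carries one [x], while the result absorbs only one; hence the extra ['X]. *)
Lemma mul_xeval x p q : m (xeval x p) (xeval x q) = xeval x (p * q * 'X).
Proof.
elim/poly_mono_ind: p => [|p1 p2 IH1 IH2|a i].
- by rewrite !mul0r peval0 mul0v.
- by rewrite pevalD mulvDl IH1 IH2 !mulrDl pevalD.
elim/poly_mono_ind: q => [|q1 q2 IH1 IH2|b j].
- by rewrite mulr0 mul0r peval0 mulv0.
- by rewrite pevalD mulvDr IH1 IH2 mulrDr mulrDl pevalD.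
rewrite -!scalerAl -scalerAr -!scalerAl !pevalZ mulZv mulvZ -exprD -exprSr.
by rewrite !pevalXn npowD.
Qed.

Lemma xeval_comm x p q : m (xeval x p) (xeval x q) = m (xeval x q) (xeval x p).
Proof. by rewrite !mul_xeval (mulrC p). Qed.

Lemma xeval_mul0 x p q : xeval x p = 0 -> xeval x (p * q) = 0.
Proof.
move=> p0; elim/poly_mono_ind: q => [|q1 q2 IH1 IH2|a [|i]].
- by rewrite mulr0 peval0.
- by rewrite mulrDr pevalD IH1 IH2 addr0.
- by rewrite expr0 -scalerAr pevalZ mulr1 p0 scaler0.
by rewrite -scalerAr pevalZ exprSr mulrA -mul_xeval p0 mul0v scaler0.
Qed.

(** * Units of one-generated subalgebras *)

Hypothesis m_alg : algebraic_alg m.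
Hypothesis m_dom : no_zero_divisors m.

Lemma xeval_alg x : exists2 p : {poly F}, p != 0 & xeval x p = 0.
Proof.
have [p [pn0 p0 px]] := m_alg x.
have [q pE] : exists q, p = q * 'X.
  by apply/dvdpP; rewrite -['X]subr0 -polyC0 dvdp_XsubCl /root horner_coef0 p0.
exists q; first by apply: contraNneq pn0 => q0; rewrite pE q0 mul0r.
have qn0 : q != 0 by apply: contraNneq pn0 => q0; rewrite pE q0 mul0r.
move: px; rewrite pE size_mulX // big_add1 big_mkord /= => <-.
by apply: eq_bigr => i _; rewrite coefMX.
Qed.

Lemma mulv_inj x y z : z != 0 -> m x z = m y z -> x = y.
Proof.
move=> zn0 /eqP; rewrite -subr_eq0 -mulNv -mulvDl => /eqP /m_dom [/eqP|z0].
  by rewrite subr_eq0 => /eqP.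
by rewrite z0 eqxx in zn0.
Qed.

Lemma mulvI x y z : z != 0 -> m z x = m z y -> x = y.
Proof.
move=> zn0 /eqP; rewrite -subr_eq0 -mulvN -mulvDr => /eqP /m_dom [z0|/eqP].
  by rewrite z0 eqxx in zn0.
by rewrite subr_eq0 => /eqP.
Qed.

(** Factors ['X] of an annihilating polynomial can be cancelled until its constant term [c] is
    nonzero. Then [x (p(x) x + c) = 0] makes [- c^-1 x p(x)] a unit. *)
Lemma xeval_unit x : x != 0 ->
  exists r, forall p, m (xeval x r) (xeval x p) = xeval x p.
Proof.
move=> xn0; have [p pn0 px] := xeval_alg x.
elim/poly_ind: p pn0 px => [|p c IHp]; first by rewrite eqxx.
have [->|cn0] := eqVneq c 0.
  rewrite addr0 -[p]mulr1 -mul_xeval xeval1 mulr1 => pXn0.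
  move=> /m_dom [px|x0]; last by rewrite x0 eqxx in xn0.
  by apply: IHp => //; apply: contraNneq pXn0 => ->; rewrite mul0r.
move=> _ pcx; exists (- c^-1 *: p) => q; rewrite mul_xeval.
have -> : - c^-1 *: p * q * 'X = q - (p * 'X + c%:P) * (c^-1 *: q).
  rewrite -!mul_polyC polyCN mulrDl (mulrA c%:P) -polyCM divff // mul1r opprD.
  rewrite addrCA subrr addr0 !mulNr mulrACA -mulrA; congr (- _).
  by rewrite (mulrC p) (mulrC 'X).
by rewrite pevalD pevalN xeval_mul0 // subr0.
Qed.

(** * The operator [x |-> e x + x e] *)

(* With [u = e + x] we get [x^2 = u^2 - u], so the fields generated by [x] and
   by [u] meet and have the same unit, which must then be [e]. *)
Lemma sym_idem_inj e x : e != 0 -> m e e = e -> m e x + m x e = x -> x = 0.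
Proof.
move=> en0 ee ex; apply/eqP/negPn/negP => xn0.
pose u := e + x.
have sq : m u u - u = m x x.
  rewrite /u !mulvDl !mulvDr ee; apply: zmod_subst ex _; zmod.
have xx : m x x != 0 by apply: contraNneq xn0 => /m_dom [] ->.
have un0 : u != 0.
  by apply: contraNneq xx => u0; rewrite -sq u0 mul0v subr0.
have [f fP] := xeval_unit x xn0; have [g gP] := xeval_unit u un0.
have fx : m (xeval x f) x = x by have := fP 1; rewrite xeval1.
have gu : m (xeval u g) u = u by have := gP 1; rewrite xeval1.
have xf : m x (xeval x f) = x by rewrite -{1}(xeval1 x) xeval_comm xeval1.
have fg : xeval x f = xeval u g.
  apply: (mulv_inj _ _ (m x x)) => //.
  transitivity (m x x).
    by have := fP (1 * 1 * 'X); rewrite -mul_xeval xeval1.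
  have := gP (1 * 1 * 'X - 1).
  by rewrite pevalD pevalN -mul_xeval xeval1 sq.
(* The common unit fixes [u] and [x], hence also [e = u - x]; cancelling [e] identifies it with
   [e]. *)
have fe : xeval x f = e.
  apply: (mulv_inj _ _ e) => //; rewrite ee; apply: (addIr x).
  by have := gu; rewrite -fg /u mulvDr fx.
move: ex; rewrite -fe fx xf => /eqP; rewrite -subr_eq0 addrK => /eqP x0.
by rewrite x0 eqxx in xn0.
Qed.

(** * Linear dependence of iterated squares *)

Let sqr x := m x x.

Lemma iter_sqr_xeval y i : exists p, iter i sqr y = xeval y p.
Proof.
elim: i => [|i [p IHi]]; first by exists 1; rewrite xeval1.
by exists (p * p * 'X); rewrite -mul_xeval -IHi.
Qed.

Lemma iter_sqr_dep y :
  exists2 p : {poly F}, p != 0 & peval (fun i => iter i sqr y) p = 0.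
Proof.
have [p pn0 py] := xeval_alg y.
(* In closed form [g i] is ['X^(2^i - 1)]. *)
pose g i := iter i (fun q : {poly F} => q * q * 'X) 1.
have gP i : iter i sqr y = xeval y (g i).
  elim: i => [|i IHi]; first by rewrite xeval1.
  by rewrite /= -mul_xeval -IHi.
pose d := size p.
have d_gt0 : (0 < d)%N by rewrite size_poly_gt0.
(* Residues modulo [p] have [d - 1] coefficients, so these [d] rows are dependent; [r] is a
   dependence relation. *)
pose M : 'M[F]_(d, d.-1) := \matrix_i poly_rV (g i %% p).
pose r := nz_row (kermx M).
have rn0 : r != 0.
  rewrite nz_row_eq0 -mxrank_eq0 mxrank_ker subn_eq0 -ltnNge.
  by rewrite (leq_ltn_trans (rank_leq_col M)) // prednK.
have rM : r *m M = 0 by apply/sub_kermxP; apply: nz_row_sub.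
exists (rVpoly r).
  by apply: contraNneq rn0 => r0; rewrite -(rVpolyK r) r0 linear0.
rewrite (pevalE _ _ d) ?size_poly //.
have : \sum_i r 0 i *: (g i %% p) = 0.
  have := congr1 rVpoly rM; rewrite mulmx_sum_row linear0 linear_sum /= => rM0.
  rewrite -[RHS]rM0; apply: eq_bigr => i _; rewrite linearZ /= rowK poly_rV_K //.
  by rewrite -ltnS prednK // ltn_modp.
have gmod i : xeval y (g i %% p) = iter i sqr y.
  rewrite gP {2}(divp_eq (g i) p) mulrC pevalD.
  by rewrite xeval_mul0 // add0r.
move=> /(congr1 (xeval y)).
rewrite (big_morph _ (pevalD _) (peval0 _)) peval0 => H.
rewrite -[RHS]H; apply: eq_bigr => i _; by rewrite coef_rVpoly_ord pevalZ gmod.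
Qed.

(** * Identities in characteristic different from two *)

Section Quartic.
Hypothesis two_inj : forall v : A, v + v = 0 -> v = 0.

(** Subtracting the cube identities at [e + y] and [e - y] keeps the terms of odd degree in [y]; the
    cubic ones cancel, leaving twice the linear part. *)
Lemma idem_commute e y : m e e = e ->
  let k := m e y + m y e - y in m e k = m k e.
Proof.
move=> ee k.
have cube x : m (m x x) x = m x (m x x) by rewrite -[LHS](npowD x 0 1).
apply/eqP; rewrite -subr_eq0; apply/eqP/two_inj.
have := cube (e + y); have := cube (e - y); rewrite /k.
rewrite !(mulvDl, mulvDr, mulNv, mulvN) !opprK !ee cube => H1 H2.
apply: zmod_subst (congr2 (fun a b => a - b) H1 H2) _; zmod.
Qed.

(* The part of [x^2 x^2 - x^3 x], polarized at [x + y], that is linear in [y]. *)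
Let B x y := m (m x x) (m x y + m y x) + m (m x y + m y x) (m x x)
  - m (m (m x y + m y x) x + m (m x x) y) x - m (m (m x x) x) y.

Let BDr x y v : B x (y + v) = B x y + B x v.
Proof. by rewrite /B !(mulvDl, mulvDr); zmod. Qed.

Let BNr x y : B x (- y) = - B x y.
Proof. by rewrite /B !(mulvDl, mulvDr, mulvN, mulNv); zmod. Qed.

(** The odd part in [y] of the quartic identity at [x + y] is [B x y] in degree 1 plus [B y x] in
    degree 3. Consequently [B], cubic in [x] by its formula, is additive there. *)
Let BC x y : B x y = - B y x.
Proof.
have quart v : m (m v v) (m v v) = m (m (m v v) v) v by exact: (npowD v 1 1).
apply/eqP; rewrite -addr_eq0; apply/eqP/two_inj.
have := quart (x + y); have := quart (x - y); rewrite /B.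
rewrite !(mulvDl, mulvDr, mulNv, mulvN, opprD, opprK) !quart => H1 H2.
apply: zmod_subst (congr2 (fun a b => b - a) H1 H2) _; zmod.
Qed.

Let BDl x y v : B (x + y) v = B x v + B y v.
Proof. by rewrite BC BDr opprD -!(BC _ v). Qed.

Let BNl x v : B (- x) v = - B x v.
Proof. by rewrite BC BNr -(BC x). Qed.

Let Bxx x : B x x = 0.
Proof. by apply: two_inj; rewrite {1}BC addNr. Qed.

(** Every term is a multiple of [x^5], and the coefficients are 2 + 2 - 3 - 1. *)
Let B_sqr x : B x (m x x) = 0.
Proof.
have h01 : m x (m x x) = npow m x 2 := npowD x 0 1.
have h10 : m (m x x) x = npow m x 2 := npowD x 1 0.
have h11 : m (m x x) (m x x) = npow m x 3 := npowD x 1 1.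
have h20 : m (npow m x 2) x = npow m x 3 := npowD x 2 0.
have h30 : m (npow m x 3) x = npow m x 4 := npowD x 3 0.
have h12 : m (m x x) (npow m x 2) = npow m x 4 := npowD x 1 2.
have h21 : m (npow m x 2) (m x x) = npow m x 4 := npowD x 2 1.
by rewrite /B h01 h10 !(mulvDl, mulvDr) h12 h21 h11 h20 h30; zmod.
Qed.

(* Comparing [B_sqr] at [e + y] and at [e - y]. *)
Let B_idem e y : m e e = e -> B e (m e y + m y e - y) = 0.
Proof.
move=> ee; apply: two_inj.
have := B_sqr (e + y); have := B_sqr (e - y).
rewrite !(mulvDl, mulvDr, mulNv, mulvN) opprK ee.
rewrite !(BDl, BDr, BNl, BNr) Bxx !B_sqr (BC y e) => H1 H2.
apply: zmod_subst (congr2 (fun a b => b - a) H1 H2) _; zmod.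
Qed.

Lemma sym_idem_image e y : e != 0 -> m e e = e ->
  let k := m e y + m y e - y in m e k = k /\ m k e = k.
Proof.
move=> en0 ee k.
have halve (u v : A) : u + u = v + v -> u = v.
  move=> uv; apply/eqP; rewrite -subr_eq0; apply/eqP/two_inj.
  by apply: zmod_subst uv _; zmod.
have ek : m e k = m k e by apply: idem_commute.
(* If [e] commutes with [v], this and halving show that [e] commutes with [m e v]. *)
have comm2 v : m e (m e v + m v e) - m e v = m (m e v + m v e) e - m v e.
  by have := idem_commute e v ee; rewrite /= !(mulvDl, mulvDr, mulvN, mulNv).
have ea : m e (m e k) = m (m e k) e.
  have := comm2 k; rewrite -ek => /addIr; rewrite mulvDr mulvDl; exact: halve.
have eea : m e (m e (m e k)) = m (m e (m e k)) e.
  have := comm2 (m e k); rewrite -ea => /addIr; rewrite mulvDr mulvDl; exact: halve.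
have := B_idem e y ee; rewrite -/k; clearbody k => Bk.
(* With [L] the multiplication by [e], [B e k = 0] reads [L (2 L - 1) (L - 1) k = 0]. Cancelling [L]
   gives [2 L b = b], which [sym_idem_inj] excludes unless [b = 0]. *)
pose b := m e k - k.
have b0 : b = 0.
  apply: (sym_idem_inj e) => //; rewrite /b.
  apply: (mulvI _ _ e) => //.
  have := Bk; rewrite /B !ee -ek !(mulvDl, mulvDr) -ea -eea.
  rewrite !(mulvN, mulNv) -ek => H.
  apply: zmod_subst (esym H) _; zmod.
have ekk : m e k = k by apply/eqP; rewrite -subr_eq0 -/b b0.
by rewrite -ek.
Qed.

End Quartic.

(** * Rota-Baxter operators *)

Variable R : A -> A.
Hypothesis R_rb : rota_baxter m 0 R.

Let RD x y : R (x + y) = R x + R y.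
Proof. by have := R_rb.1 1 x y; rewrite !scale1r. Qed.

Let R0 : R 0 = 0.
Proof. by apply: (addrI (R 0)); rewrite -RD !addr0. Qed.

Let RZ a x : R (a *: x) = a *: R x.
Proof. by have := R_rb.1 a x 0; rewrite R0 !addr0. Qed.

Let RN x : R (- x) = - R x.
Proof. by rewrite -scaleN1r RZ scaleN1r. Qed.

Let R_mul x y : m (R x) (R y) = R (m (R x) y + m x (R y)).
Proof. by rewrite R_rb.2 scale0r addr0. Qed.

Lemma xeval_rb_image x p : exists z, xeval (R x) p = R z.
Proof.
elim/poly_mono_ind: p => [|p q [u IHp] [v IHq]|a n].
- by exists 0; rewrite peval0 R0.
- by exists (u + v); rewrite pevalD IHp IHq RD.
rewrite pevalZ pevalXn.
suff [z ->] : exists z, npow m (R x) n = R z by exists (a *: z); rewrite RZ.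
elim: n => [|n [z IHn]] /=; first by exists x.
by exists (m (R z) x + m z (R x)); rewrite IHn R_mul.
Qed.

Lemma rb_idem x : R x != 0 -> exists z, R z != 0 /\ m (R z) (R z) = R z.
Proof.
move=> Rx; have [r rP] := xeval_unit (R x) Rx.
have [z zE] := xeval_rb_image x r; exists z; rewrite -zE rP; split=> //.
apply: contraNneq Rx => r0.
by have := rP 1; rewrite xeval1 r0 mul0v => <-.
Qed.

Section Idempotent.
Variable z : A.
Let e := R z.
Hypothesis en0 : e != 0.
Hypothesis ee : m e e = e.
Let T x := m e x + m x e.

Let T_lin a x y : T (a *: x + y) = a *: T x + T y.
Proof. by rewrite /T mulvDr mulvDl mulvZ mulZv scalerDr; zmod. Qed.

Let TD x y : T (x + y) = T x + T y.
Proof. by rewrite /T mulvDr mulvDl; zmod. Qed.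

Let TN x : T (- x) = - T x.
Proof. by rewrite /T mulvN mulNv; zmod. Qed.

Let RTz : R (T z) = e.
Proof. by rewrite -R_mul. Qed.

Let RT_ker v : R v = 0 -> R (T v) = 0.
Proof.
move=> Rv; have := R_mul z v; have := R_mul v z.
rewrite Rv !mulv0 !mul0v addr0 add0r => Rve Rev.
by rewrite RD -Rve -Rev addr0.
Qed.

Lemma rb_char2 : (forall v : A, v + v = 0) -> False.
Proof.
move=> vv.
have oppv (v : A) : - v = v by apply: (addrI v); rewrite subrr vv.
pose br x y := m x y + m y x.
pose S x := x + T x.
have [p pn0 py] := iter_sqr_dep (T (T z)).
pose w := T (T (T (T z))).
have key n : T (T (iter n sqr (T (T z)))) = iter n S w.
  apply: (iter_sqr A br sqr vv) => //.
  - by move=> x y v; rewrite /br mulvDl mulvDr; zmod.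
  - by move=> x y; rewrite /br addrC.
  - by move=> x; apply: vv.
  - by move=> x y; rewrite /sqr /br mulvDl !mulvDr; zmod.
  - move=> x; rewrite /br /sqr -(xeval1 x) mul_xeval xeval_comm; exact: vv.
  move=> k; have [q ->] := iter_sqr_xeval (T (T z)) k.
  have := xeval_comm (T (T z)) q 1; rewrite xeval1 /br => ->; exact: vv.
have S_lin a x y : S (a *: x + y) = a *: S x + S y.
  by rewrite /S T_lin (scalerDr a x (T x)); zmod.
have S_inj x : S x = 0 -> x = 0.
  move=> /eqP; rewrite addr_eq0 oppv => /eqP xT.
  by apply: (sym_idem_inj e) => //; rewrite {3}xT.
(* [T v - v] lies in the kernel of [R], which [T] preserves; so [R] takes the value [e] all along
   the orbit of [z] under [T]. *)
have RS v : R v = e -> R (T v) = e -> R (T (T v)) = e.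
  move=> Rv RTv; have : R (T v - v) = 0 by rewrite RD RN RTv Rv subrr.
  move=> /RT_ker; rewrite TD TN (RD (T (T v))) RN RTv => /eqP.
  by rewrite subr_eq0 => /eqP.
have RT2 := RS z erefl RTz; have RT3 := RS _ RTz RT2.
have Rw := RS _ RT2 RT3; have RTw := RS _ RT3 Rw.
(* The first step gives [e + e = 0], and [S] preserves the kernel of [R]. *)
have RSw i : R (iter i.+1 S w) = 0.
  elim: i => [|i IHi]; first by rewrite /= /S RD Rw RTw vv.
  by rewrite iterS {1}/S RD IHi RT_ker // addr0.
have : peval (fun i => iter i S w) p = 0.
  transitivity (T (T (peval (fun i => iter i sqr (T (T z))) p))).
    rewrite !(peval_linear T) //.
    by apply: eq_bigr => i _ /=; rewrite key.
  by rewrite py /T !(mulv0, mul0v) addr0 !(mulv0, mul0v) addr0.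
(* Injectivity of [S] strips factors ['X] from [p]. Once the constant term [c] is nonzero, applying
   [R] to the relation leaves [c *: e = 0]. *)
elim/poly_ind: p pn0 {py} => [|p c IHp]; first by rewrite eqxx.
rewrite pevalD pevalMX pevalC.
have [->|cn0] := eqVneq c 0 => pn0.
  rewrite scale0r addr0.
  have -> : peval (fun i => iter i.+1 S w) p = S (peval (fun i => iter i S w) p).
    by rewrite (peval_linear S).
  move=> /S_inj; apply: IHp; apply: contraNneq pn0 => ->.
  by rewrite mul0r addr0.
move=> /(congr1 R); rewrite RD RZ (peval_linear R) ?R0; last exact: R_rb.1.
rewrite /peval big1 => [|i _]; last by rewrite [(R \o _) _]RSw scaler0.
by move=> /eqP; rewrite add0r scaler_eq0 (negPf cn0) Rw (negPf en0).
Qed.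

Lemma rb_char_neq2 : (forall v : A, v + v = 0 -> v = 0) -> False.
Proof.
move=> two_inj; pose k := T z - z.
have [ek ke] : m e k = k /\ m k e = k by apply: sym_idem_image.
have Rk : R k = 0 by rewrite RD RN RTz subrr.
have zk : m e z + m z e = z + k by rewrite /k /T; zmod.
clearbody k.
(* From [T z = z + k] and [T k = 2 k] it follows that [T] fixes [z - k]. *)
have : z - k = 0.
  apply: (sym_idem_inj e) => //; rewrite !(mulvDl, mulvDr, mulvN, mulNv) ek ke.
  by apply: zmod_subst zk _; zmod.
by move=> /(congr1 R) /eqP; rewrite RD RN Rk R0 subr0 (negPf en0).
Qed.

End Idempotent.
End Algebra.

Theorem theorem2 (F : fieldType) (A : lmodType F) (m : A -> A -> A)
  (R : A -> A) :
  bilinear_prod m -> power_associative m -> algebraic_alg m ->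
  no_zero_divisors m -> rota_baxter m 0 R ->
  forall x : A, R x = 0.
Proof.
move=> m_bil m_pa m_alg m_dom R_rb x; apply/eqP/negPn/negP => Rx.
have [z [en0 ee]] := rb_idem F A m m_bil m_pa m_alg m_dom R R_rb x Rx.
have [two0|two_n0] := eqVneq (1 + 1 : F) 0.
  apply: (rb_char2 F A m m_bil m_pa m_alg m_dom R R_rb z en0 ee) => v.
  by rewrite -{1 2}(scale1r v) -scalerDl two0 scale0r.
apply: (rb_char_neq2 F A m m_bil m_pa m_alg m_dom R R_rb z en0 ee) => v.
rewrite -{1 2}(scale1r v) -scalerDl => /eqP.
by rewrite scaler_eq0 (negPf two_n0) => /eqP.
Qed.
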